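(* For the Pulse update on the complete directed graph $K_n^\rightarrow$ with vertex set $V$, every orbit eventually enters either a fixed point or a complement two-cycle $S\longleftrightarrow V\setminus S$.
   Context: $K_n^\rightarrow$ denotes the complete directed graph on $n$ vertices with no self-loops: for every pair of vertices $u\neq v$ the edge $u\to v$ is present. The Pulse update on a loopless directed graph $(V,E)$ acts on states $x_t:V\to\{0,1\}$ synchronously: with $k_t(v)=\sum_{u:(u,v)\in E}x_t(u)$, one sets $x_{t+1}(v)=1$ if $k_t(v)$ is a prime number and $x_{t+1}(v)=0$ otherwise. States are identified with their active sets $S_t=\{v\in V:x_t(v)=1\}\subseteq V$. A fixed point is a state that the update leaves unchanged. A complement two-cycle is a periodic orbit consisting of two states $S$ and $V\setminus S$, where $S$ is mapped to $V\setminus S$ and $V\setminus S$ is mapped to $S$. *)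

(* Defs.v *)
From mathcomp Require Import all_boot.

Set Implicit Arguments.
Unset Strict Implicit.
Unset Printing Implicit Defensive.

(* [edge u v] is the directed edge u -> v. *)
Record loopless_digraph (V : finType) := LooplessDigraph {
  edge :> rel V;
  edge_irr : irreflexive edge
}.

Lemma neq_irr (V : finType) : irreflexive [rel u v : V | u != v].
Proof. by move=> v /=; rewrite eqxx. Qed.

Definition complete_digraph (V : finType) : loopless_digraph V :=
  LooplessDigraph (@neq_irr V).

Notation state V := {ffun V -> bool}.

Definition active_set (V : finType) (x : state V) : {set V} := [set v | x v].

Definition state_of_set (V : finType) (S : {set V}) : state V :=
  [ffun v => v \in S].

Lemma active_setK (V : finType) : cancel (@active_set V) (@state_of_set V).
Proof. by move=> x; apply/ffunP => v; rewrite ffunE inE. Qed.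

Lemma state_of_setK (V : finType) : cancel (@state_of_set V) (@active_set V).
Proof. by move=> S; apply/setP => v; rewrite inE ffunE. Qed.

(* The booleans [x u] are summed as the naturals 0 and 1. *)
Definition active_in_count (V : finType) (G : loopless_digraph V)
    (x : state V) (v : V) : nat :=
  \sum_(u | G u v) x u.

Definition pulse (V : finType) (G : loopless_digraph V) (x : state V) :
    state V :=
  [ffun v => prime (active_in_count G x v)].

Definition orbit_state (V : finType) (G : loopless_digraph V)
    (x0 : state V) (t : nat) : state V :=
  iter t (pulse G) x0.

Definition fixed_point (V : finType) (G : loopless_digraph V)
    (x : state V) : Prop :=
  pulse G x = x.

(* The first conjunct makes the orbit have two states; it fails only for the
   empty vertex set. *)
Definition complement_two_cycle (V : finType) (G : loopless_digraph V)
    (S : {set V}) : Prop :=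
  [/\ S <> ~: S,
      pulse G (state_of_set S) = state_of_set (~: S) &
      pulse G (state_of_set (~: S)) = state_of_set S].

(* Main.v *)
Require Import Defs.
From mathcomp Require Import all_boot.

(** On the complete digraph a vertex [v] counts every active vertex except
    itself.  With [m] active vertices, an inactive vertex therefore sees [m] and
    an active one sees [m - 1], so the update depends only on two bits:
    primality of [m] and of [m - 1].  The four cases are
    - both equal: every vertex receives the same value, and the new state is
      empty or full;
    - only [m - 1] prime: active vertices stay active and inactive ones stay
      inactive, a fixed point;
    - only [m] prime: every vertex flips.
    This is [pulse_trichotomy].  The empty state is fixed, and the full state
    is either fixed or sent to the empty one ([settles_const]).  What remains is
    a state [x] that flips to its complement; applying the same trichotomy to
    the complement, either it leads to a state already treated or it flips
    back, which is a complement two-cycle. *)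

Section CompleteDigraph.

Variable V : finType.
Implicit Types (x : state V) (c : bool).

Local Notation K := (complete_digraph V).

Definition settles x : Prop :=
  exists t : nat,
    fixed_point K (orbit_state K x t) \/
    complement_two_cycle K (active_set (orbit_state K x t)).

Lemma settles_fixed x : pulse K x = x -> settles x.
Proof. by move=> fix_x; exists 0; left. Qed.

Lemma settles_pulse x : settles (pulse K x) -> settles x.
Proof. by case=> t; rewrite /orbit_state -iterSr => Ht; exists t.+1. Qed.

Lemma active_in_count_complete x (v : V) :
  active_in_count K x v = #|active_set x| - x v.
Proof.
have -> : #|active_set x| = \sum_u x u.
  by rewrite -sum1_card big_mkcond; apply: eq_bigr => u _; rewrite inE; case: (x u).
rewrite (bigD1 v) //= addKn /active_in_count.
by apply: eq_bigl.
Qed.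

(** The update has no memory beyond the two bits, one shared by all active
    vertices and one by all inactive ones; equal bits erase the state, and
    distinct bits preserve or negate it. *)
Lemma pulse_trichotomy x :
  [\/ exists c, pulse K x = [ffun=> c],
      pulse K x = x
    | pulse K x = [ffun v => ~~ x v]].
Proof.
set m := #|active_set x|.
have pulseE v : pulse K x v = if x v then prime (m - 1) else prime m.
  by rewrite ffunE active_in_count_complete -/m; case: (x v); rewrite ?subn0.
case Em1: (prime (m - 1)) pulseE; case Em: (prime m) => pulseE.
- by apply: Or31; exists true; apply/ffunP => v; rewrite pulseE ffunE if_same.
- by apply: Or32; apply/ffunP => v; rewrite pulseE; case: (x v).
- by apply: Or33; apply/ffunP => v; rewrite pulseE ffunE; case: (x v).
- by apply: Or31; exists false; apply/ffunP => v; rewrite pulseE ffunE if_same.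
Qed.

Lemma pulse_const c :
  pulse K [ffun=> c] = [ffun=> prime (#|active_set [ffun _ : V => c]| - c)].
Proof. by apply/ffunP => v; rewrite !ffunE active_in_count_complete ffunE. Qed.

(** A constant state can only move downwards: in the empty state every count is
    0, which is not prime, while the full state stays constant because
    all counts in it agree. *)
Lemma settles_const c : settles [ffun=> c].
Proof.
have settles0 : settles [ffun=> false].
  apply: settles_fixed; rewrite pulse_const subn0.
  suff -> : active_set [ffun _ : V => false] = set0 by rewrite cards0.
  by apply/setP => v; rewrite !inE ffunE.
case: c => //; have := pulse_const true; case: (prime _) => pulse1.
  exact: settles_fixed.
by apply: settles_pulse; rewrite pulse1.
Qed.

Lemma state_of_setC x :
  state_of_set (~: active_set x) = [ffun v => ~~ x v].
Proof. by apply/ffunP => v; rewrite !ffunE !inE. Qed.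

Lemma settles_flip_flip x :
  pulse K x = [ffun v => ~~ x v] -> pulse K [ffun v => ~~ x v] = x ->
  settles x.
Proof.
rewrite -state_of_setC => flip_x flip_Cx; exists 0.
have [selfC | not_selfC] := eqVneq (active_set x) (~: active_set x).
  (* A set equals its complement only when [V] is empty; its unique state is
     then fixed. *)
  by left; rewrite /fixed_point flip_x -selfC active_setK.
by right; split; rewrite ?active_setK //; apply/eqP.
Qed.

Lemma state_settles x : settles x.
Proof.
have [[c xc] | fix_x | flip_x] := pulse_trichotomy x.
- by apply: settles_pulse; rewrite xc; apply: settles_const.
- exact: settles_fixed.
have [[c yc] | fix_y | flip_y] := pulse_trichotomy [ffun v => ~~ x v].
- by do 2!apply: settles_pulse; rewrite flip_x yc; apply: settles_const.
- by apply: settles_pulse; rewrite flip_x; apply: settles_fixed.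
apply: settles_flip_flip => //; rewrite flip_y.
by apply/ffunP => v; rewrite !ffunE negbK.
Qed.

End CompleteDigraph.

Theorem theorem12 (V : finType) (x0 : state V) :
  exists t : nat,
    fixed_point (complete_digraph V) (orbit_state (complete_digraph V) x0 t) \/
    complement_two_cycle (complete_digraph V)
      (active_set (orbit_state (complete_digraph V) x0 t)).
Proof. exact: state_settles. Qed.
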